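(* Let $\delta>\frac{\pi^2}{4}-1$ and $\sigma_w^2=0$. For every $\alpha_0\in\mathbb{R}\setminus\{0\}$ and every $\sigma_0^2\in[0,\infty)$, the real SE sequences satisfy $$\lim_{t\to\infty}|\alpha_t|=1\qquad\text{and}\qquad\lim_{t\to\infty}\sigma_t^2=0.$$
   Context: Real state evolution. Fix $\delta>0$, $\sigma_w^2\ge0$. For $\alpha\in\mathbb{R}$, $\sigma^2\ge0$, $(\alpha,\sigma^2)\ne(0,0)$, with $\sigma=\sqrt{\sigma^2}$ and the convention $\arctan(\alpha/0)=\frac\pi2\,\mathrm{sign}(\alpha)$, define $$\psi_1(\alpha,\sigma^2)=\frac2\pi\arctan\Big(\frac\alpha\sigma\Big),\qquad \psi_2(\alpha,\sigma^2;\delta,\sigma_w^2)=\frac1\delta\Big[\alpha^2+\sigma^2+1-\frac{4\sigma}{\pi}-\frac{4\alpha}{\pi}\arctan\Big(\frac\alpha\sigma\Big)\Big]+\sigma_w^2 .$$ The real SE sequences are $\alpha_{t+1}=\psi_1(\alpha_t,\sigma_t^2)$, $\sigma_{t+1}^2=\psi_2(\alpha_t,\sigma_t^2;\delta,\sigma_w^2)$, $t\ge0$. *)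

(* Defs.v *)
From Stdlib Require Import Reals Lra.
Open Scope R_scope.

(* arctan(alpha/sigma) with the convention arctan(alpha/0) = (pi/2) sign(alpha)
   (for alpha = 0, sigma = 0 this gives 0; that point is excluded by the paper). *)
Definition atan_ratio (alpha sigma : R) : R :=
  if Req_EM_T sigma 0 then
    (if Rlt_dec 0 alpha then PI / 2
     else if Rlt_dec alpha 0 then - (PI / 2) else 0)
  else atan (alpha / sigma).

Definition psi1 (alpha s2 : R) : R :=
  2 / PI * atan_ratio alpha (sqrt s2).

Definition psi2 (alpha s2 delta sw2 : R) : R :=
  / delta * (alpha ^ 2 + s2 + 1 - 4 * sqrt s2 / PI
             - 4 * alpha / PI * atan_ratio alpha (sqrt s2)) + sw2.

Fixpoint SE (delta sw2 alpha0 s20 : R) (t : nat) : R * R :=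
  match t with
  | O => (alpha0, s20)
  | S t' => let p := SE delta sw2 alpha0 s20 t' in
            (psi1 (fst p) (snd p), psi2 (fst p) (snd p) delta sw2)
  end.

Definition alpha_seq delta sw2 alpha0 s20 (t : nat) : R := fst (SE delta sw2 alpha0 s20 t).
Definition sigma2_seq delta sw2 alpha0 s20 (t : nat) : R := snd (SE delta sw2 alpha0 s20 t).

(* Main.v *)
Require Import Defs.
From Stdlib Require Import Reals Lra Lia Machin.
Open Scope R_scope.

(** Take alpha > 0 and write theta = arctan(alpha / sigma), so that the next alpha is 2 theta /
    PI, and let g(a) = a cot(PI a / 2), so that sigma = g(a) is the curve of fixed points of
    psi1. The boxes {alpha >= a, sigma <= g(a)} increase to {alpha > 0, sigma < 2/PI} as a -> 0
    and shrink to the limit point (1, 0) as a -> 1. The next alpha stays >= a on the box, and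
    the next sigma^2 is at most q max(sigma^2, g(alpha)^2) with q < 1: the threshold PI^2/4 - 1
    is exactly what makes psi2 < sigma^2 on the curve sigma = g(alpha) up to alpha = 0, and the
    points (alpha, 0) with alpha small, where the bound would fail, are excluded because delta
    psi2 = (alpha - alpha')^2 + (sigma - 2/PI)^2 + 1 - 4/PI^2 - alpha'^2 bounds sigma^2 from
    below after one step. Hence every orbit enters some box, and with tau = tan(PI a / 2) it
    moves within two steps from the box of tau to that of tau / sqrt q. *)

(** * Numerical bounds for PI, sine and cosine *)

Lemma PI_bounds : 3.1415 < PI < 3.1416.
Proof.
  pose proof (PI_2_3_7_ineq 2) as H.
  unfold tg_alt, PI_2_3_7_tg, Ratan_seq in H; simpl in H; lra.
Qed.

Lemma sin_upper_5 y : 0 <= y <= PI -> sin y <= y - y ^ 3 / 6 + y ^ 5 / 120.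
Proof.
  intros [H0 H1].
  destruct (sin_bound y 0 H0 H1) as [_ H].
  unfold sin_approx, sin_term in H; simpl in H; simpl; lra.
Qed.

Lemma sin_lower_3 y : 0 <= y <= PI -> y - y ^ 3 / 6 <= sin y.
Proof.
  intros [H0 H1].
  destruct (sin_bound y 0 H0 H1) as [H _].
  unfold sin_approx, sin_term in H; simpl in H; simpl; lra.
Qed.

Lemma cos_upper_4 y : 0 <= y <= PI / 2 -> cos y <= 1 - y ^ 2 / 2 + y ^ 4 / 24.
Proof.
  intros [H0 H1].
  assert (Hm : - PI / 2 <= y) by (pose proof PI_RGT_0; lra).
  destruct (cos_bound y 0 Hm H1) as [_ H].
  unfold cos_approx, cos_term in H; simpl in H; simpl; lra.
Qed.

Lemma cos_lower_6 y :
  0 <= y <= PI / 2 -> 1 - y ^ 2 / 2 + y ^ 4 / 24 - y ^ 6 / 720 <= cos y.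
Proof.
  intros [H0 H1].
  assert (Hm : - PI / 2 <= y) by (pose proof PI_RGT_0; lra).
  destruct (cos_bound y 1 Hm H1) as [H _].
  unfold cos_approx, cos_term in H; simpl in H; simpl; lra.
Qed.

(** The inequality x <= tan x without division, so that x = PI/2 is included. The Taylor bounds
    reduce it to x^2 <= 8. *)
Lemma x_cos_le_sin x : 0 <= x <= PI / 2 -> x * cos x <= sin x.
Proof.
  intros Hx. pose proof PI_bounds.
  pose proof (sin_lower_3 x ltac:(lra)).
  pose proof (cos_upper_4 x Hx).
  assert (x * cos x <= x * (1 - x ^ 2 / 2 + x ^ 4 / 24))
    by (apply Rmult_le_compat_l; lra).
  assert (0 <= x ^ 3 * (8 - x ^ 2)).
  { apply Rmult_le_pos; [apply pow_le; lra | nra]. }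
  nra.
Qed.

(** * The trigonometric inequality on the fixed-point curve *)

(* Becomes an equality at both ends: c = 1 for theta -> 0, c = 0 for theta -> PI/2. *)
Lemma fixed_curve_ineq t :
  0 < t < PI / 2 ->
  let c := t * cos t / sin t in
  PI ^ 2 / 4 - t ^ 2 - 2 * c <= (PI ^ 2 / 4 - 2) * c ^ 2.
Proof.
  intros Ht c. pose proof PI_bounds as HPI.
  assert (Hs : 0 < sin t) by (apply sin_gt_0; lra).
  assert (Hc : 0 < cos t) by (apply cos_gt_0; lra).
  (* The two ends of equality are treated apart: for small t a factor z = t^2 cancels, for large t a
     factor x^2 with x = PI/2 - t. With the cut at 1.2 both remaining polynomial inequalities keep a
     positive margin. *)
  destruct (Rle_lt_dec t 1.2) as [Hsmall | Hlarge].
  - pose proof (sin_upper_5 t ltac:(lra)) as Hsu.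
    pose proof (cos_lower_6 t ltac:(lra)) as Hcl.
    set (z := t ^ 2).
    assert (Hz : 0 <= z <= 1.44) by (unfold z; nra).
    set (D := 1 - z / 6 + z ^ 2 / 120).
    set (N := 1 - z / 2 + z ^ 2 / 24 - z ^ 3 / 720).
    assert (HD : 0 < D) by (unfold D; nra).
    assert (HN : 0 < N) by (unfold N; nra).
    assert (HsD : sin t <= t * D) by (unfold D, z; nra).
    assert (HcN : N <= cos t) by (unfold N, z; nra).
    assert (Hcd : N / D <= c).
    { unfold c. apply Rmult_le_reg_r with (D * sin t); [nra|].
      replace (N / D * (D * sin t)) with (N * sin t) by (field; lra).
      replace (t * cos t / sin t * (D * sin t)) with (cos t * (t * D)) by (field; lra).
      apply Rmult_le_compat; lra. }
    set (P := PI ^ 2 / 4). fold z.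
    assert (HP : 2.467 <= P <= (987 / 400)) by (unfold P; nra).
    set (e := N / D) in *.
    (* This is P - z - 2e <= (P - 2) e^2, the claim with the lower bound [e] in place of [c],
       factored to show the zero at e = 1. *)
    assert (He : (1 - e) * (P + (P - 2) * e) <= z).
    { assert (HeD : e * D = N) by (unfold e; field; lra).
      apply Rmult_le_reg_r with (D ^ 2); [nra|].
      replace ((1 - e) * (P + (P - 2) * e) * D ^ 2)
        with ((D - e * D) * (P * D + (P - 2) * (e * D))) by ring.
      rewrite HeD.
      (* The difference D - N carries the factor z to be cancelled; afterwards P is replaced by the
         slightly larger rational 987/400. *)
      assert (HDN : D - N = z * (1 / 3 - z / 30 + z ^ 2 / 720)) by (unfold D, N; field).
      rewrite HDN, Rmult_assoc. apply Rmult_le_compat_l; [lra|].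
      apply Rle_trans with
        ((1 / 3 - z / 30 + z ^ 2 / 720) * ((987 / 400) * D + ((987 / 400) - 2) * N)).
      { apply Rmult_le_compat_l; nra. }
      (* Bernstein form of the difference on [0, 1.44] *)
      set (x := z / (36 / 25)). set (y := 1 - x).
      assert (Hx : 0 <= x) by (unfold x; lra).
      assert (Hy : 0 <= y) by (unfold y, x; lra).
      assert (Hb : forall a i j, 0 <= a -> 0 <= a * (x ^ i * y ^ j)).
      { intros a i j Ha. apply Rmult_le_pos; [exact Ha|].
        apply Rmult_le_pos; apply pow_le; assumption. }
      apply Rminus_le.
      replace ((1 / 3 - z / 30 + z ^ 2 / 720) * ((987 / 400) * D + ((987 / 400) - 2) * N) - D ^ 2) with
        (- (13 / 600 * (x ^ 0 * y ^ 5) + 5 * (5911 / 375000) * (x ^ 1 * y ^ 4)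
          + 10 * (41263 / 3750000) * (x ^ 2 * y ^ 3)
          + 10 * (17086627 / 2343750000) * (x ^ 3 * y ^ 2)
          + 5 * (13235327 / 2929687500) * (x ^ 4 * y ^ 1)
          + 188886719 / 73242187500 * (x ^ 5 * y ^ 0)))
        by (unfold y, x, D, N; field).
      pose proof (Hb (13 / 600) 0%nat 5%nat ltac:(lra)).
      pose proof (Hb (5 * (5911 / 375000)) 1%nat 4%nat ltac:(lra)).
      pose proof (Hb (10 * (41263 / 3750000)) 2%nat 3%nat ltac:(lra)).
      pose proof (Hb (10 * (17086627 / 2343750000)) 3%nat 2%nat ltac:(lra)).
      pose proof (Hb (5 * (13235327 / 2929687500)) 4%nat 1%nat ltac:(lra)).
      pose proof (Hb (188886719 / 73242187500) 5%nat 0%nat ltac:(lra)).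
      lra. }
    assert (0 < e) by (unfold e; apply Rdiv_lt_0_compat; assumption).
    assert (0 <= (c - e) * (2 + (P - 2) * (c + e))) by (apply Rmult_le_pos; nra).
    nra.
  - set (h := PI / 2). set (x := h - t).
    assert (Hh : 1.57 <= h <= 1.571) by (unfold h; lra).
    assert (Hx : 0 < x <= 0.371) by (unfold x, h in *; lra).
    assert (Est : sin t = cos x)
      by (replace x with (PI / 2 - t) by reflexivity; now rewrite cos_shift).
    assert (Ect : cos t = sin x)
      by (replace x with (PI / 2 - t) by reflexivity; now rewrite sin_shift).
    assert (Htan : x + x ^ 3 / 3 <= cos t / sin t).
    { rewrite Est, Ect in *.
      pose proof (sin_lower_3 x ltac:(lra)).
      pose proof (cos_upper_4 x ltac:(unfold h in *; lra)).
      apply Rmult_le_reg_r with (cos x); [lra|].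
      replace (sin x / cos x * cos x) with (sin x) by (field; lra).
      apply Rle_trans with ((x + x ^ 3 / 3) * (1 - x ^ 2 / 2 + x ^ 4 / 24)).
      { apply Rmult_le_compat_l; [|lra]. assert (0 <= x ^ 3) by (apply pow_le; lra). lra. }
      assert (0 <= x ^ 5 * (9 - x ^ 2)).
      { apply Rmult_le_pos; [apply pow_le; lra | nra]. }
      nra. }
    set (d := t * (x + x ^ 3 / 3)).
    assert (Hd0 : 0 <= d).
    { apply Rmult_le_pos; [lra|]. assert (0 <= x ^ 3) by (apply pow_le; lra). lra. }
    assert (Hcd : d <= c).
    { unfold c, d. replace (t * cos t / sin t) with (t * (cos t / sin t)) by (field; lra).
      apply Rmult_le_compat_l; lra. }
    assert (EP : PI ^ 2 / 4 = h ^ 2) by (unfold h; field).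
    rewrite EP.
    assert (Hlow : h ^ 2 - t ^ 2 - 2 * d <= (h ^ 2 - 2) * d ^ 2).
    { apply Rminus_le.
      replace (h ^ 2 - t ^ 2 - 2 * d - (h ^ 2 - 2) * d ^ 2) with
        (- (x ^ 2 * ((h ^ 2 - 2) * (h - x) ^ 2 * (1 + x ^ 2 / 3) ^ 2
             - 1 + 2 * h / 3 * x - 2 / 3 * x ^ 2)))
        by (unfold d; replace t with (h - x) by (unfold x; ring); field).
      apply Ropp_le_cancel. rewrite Ropp_0, Ropp_involutive.
      apply Rmult_le_pos; [apply pow_le; lra|].
      (* Here 0.4649 = 1.57^2 - 2, and (1 + x^2/3)^2 is weakened to 1 + 2 x^2/3, which leaves a
         polynomial in x alone. *)
      assert (H1 : 0.4649 * (1.57 - x) ^ 2 * (1 + 2 * x ^ 2 / 3)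
                   <= (h ^ 2 - 2) * (h - x) ^ 2 * (1 + x ^ 2 / 3) ^ 2).
      { apply Rmult_le_compat; [| nra | | nra].
        - apply Rmult_le_pos; [lra|]. apply pow_le; lra.
        - apply Rmult_le_compat; [lra | apply pow_le; lra | nra |].
          apply pow_incr; lra. }
      assert (H2 : 0 <= 0.4649 * (1.57 - x) ^ 2 * (1 + 2 * x ^ 2 / 3)
                   - 1 + 2 * 1.57 / 3 * x - 2 / 3 * x ^ 2).
      { nra. }
      assert (0 <= (h - 1.57) * x) by nra.
      lra. }
    assert (Hh2 : 0 <= h ^ 2 - 2) by nra.
    assert (0 <= (h ^ 2 - 2) * (c + d)) by (apply Rmult_le_pos; lra).
    assert (0 <= (c - d) * (2 + (h ^ 2 - 2) * (c + d))) by (apply Rmult_le_pos; lra).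
    lra.
Qed.

(** * The risk above and below the fixed-point curve *)

(** For t = arctan(al / s) this is delta times the noiseless [psi2]. The angle is a separate
    argument, tied to the point by [al * cos t = s * sin t], an equation that makes sense for s = 0
    as well. *)
Definition risk (al s t : R) : R :=
  al ^ 2 + s ^ 2 + 1 - 4 * s / PI - 4 * al * t / PI.

(* For fixed t the quotient risk / s^2 is a convex quadratic in 1 / al; it is bounded at the
   endpoint al = 2 t / PI by [fixed_curve_ineq] and at the endpoint al = 1 by cot t >= PI/2 - t. *)
Lemma risk_above_curve al s t :
  0 < t <= PI / 2 -> 2 * t / PI <= al <= 1 -> al * cos t = s * sin t ->
  risk al s t <= (PI ^ 2 / 4 - 1) * s ^ 2.
Proof.
  intros [Ht0 Ht1] Hal Hpol. pose proof PI_bounds as HPI.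
  assert (Hs : 0 < sin t) by (apply sin_gt_0; lra).
  destruct (Req_dec t (PI / 2)) as [-> | Hne].
  { rewrite cos_PI2, sin_PI2 in Hpol.
    assert (s = 0) by lra. subst s.
    replace (2 * (PI / 2) / PI) with 1 in Hal by (field; lra).
    assert (al = 1) by lra. subst al.
    unfold risk. apply Req_le. field. lra. }
  set (k := cos t / sin t).
  assert (Hk : PI / 2 - t <= k).
  { pose proof (x_cos_le_sin (PI / 2 - t) ltac:(lra)) as H.
    rewrite cos_shift, sin_shift in H.
    unfold k. apply Rmult_le_reg_r with (sin t); [assumption|].
    replace (cos t / sin t * sin t) with (cos t) by (field; lra). exact H. }
  assert (Es : s = al * k).
  { unfold k. apply Rmult_eq_reg_r with (sin t); [|lra].
    rewrite <- Hpol. field. lra. }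
  set (P := PI ^ 2 / 4). assert (HP : 2.46 <= P) by (unfold P; nra).
  (* With y = 1 / al and s = k al, the difference risk - (P - 1) s^2 equals al^2 (A - B y + y^2). *)
  set (A := 1 + k ^ 2 - (P - 1) * k ^ 2). set (B := 4 / PI * (k + t)).
  set (y1 := PI / (2 * t)).
  assert (Hal0 : 0 < al).
  { apply Rlt_le_trans with (2 * t / PI); [|lra]. apply Rdiv_lt_0_compat; lra. }
  assert (E1 : A - B + 1 <= 0).
  { assert (2 <= B).
    { unfold B. apply Rle_trans with (4 / PI * (PI / 2)).
      - apply Req_le. field. lra.
      - apply Rmult_le_compat_l; [|lra]. apply Rlt_le, Rdiv_lt_0_compat; lra. }
    assert (0 <= (P - 2) * k ^ 2) by (apply Rmult_le_pos; nra).
    unfold A. lra. }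
  assert (Ey1 : A - B * y1 + y1 ^ 2 <= 0).
  { pose proof (fixed_curve_ineq t ltac:(lra)) as H. cbv zeta in H.
    replace (t * cos t / sin t) with (t * k) in H by (unfold k; field; lra).
    apply Rmult_le_reg_r with (t ^ 2); [nra|].
    replace ((A - B * y1 + y1 ^ 2) * t ^ 2)
      with (P - t ^ 2 - 2 * (t * k) - (P - 2) * (t * k) ^ 2)
      by (unfold A, B, y1, P; field; lra).
    fold P in H. lra. }
  set (y := / al).
  assert (Hya : y * al = 1) by (unfold y; field; lra).
  assert (Hy : 1 <= y <= y1).
  { split; apply Rmult_le_reg_r with al; try lra.
    rewrite Hya. apply Rmult_le_reg_l with (2 * t / PI); [apply Rdiv_lt_0_compat; lra|].
    replace (2 * t / PI * (y1 * al)) with al by (unfold y1; field; lra). lra. }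
  assert (Ey : A - B * y + y ^ 2 <= 0).
  (* The chord of y^2 over [1, y1] lies above it; the resulting bound is affine in y, so its sign is
     settled by one of the two endpoints. *)
  { assert (y ^ 2 <= (1 + y1) * y - y1) by nra.
    destruct (Rle_lt_dec 0 (1 + y1 - B)); nra. }
  apply Rminus_le.
  replace (risk al s t - (P - 1) * s ^ 2) with (al ^ 2 * (A - B * y + y ^ 2)).
  - assert (0 <= al ^ 2) by nra. nra.
  - unfold risk, A, B, y. rewrite Es. field. lra.
Qed.

(** The quotient sin t cos t / t is sin(2t) / (2t), and the Taylor bound for sine is applied at
    2t. *)
Lemma one_minus_sinc_lower t :
  0 < t <= PI / 2 ->
  2 / 3 * t ^ 2 - 2 / 15 * t ^ 4 <= 1 - sin t * cos t / t.
Proof.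
  intros Ht. pose proof (sin_upper_5 (2 * t) ltac:(lra)) as H.
  rewrite sin_2a in H.
  apply Rmult_le_reg_r with t; [lra|].
  replace ((1 - sin t * cos t / t) * t) with (t - sin t * cos t) by (field; lra).
  lra.
Qed.

(* s + al t is the support function of a convex body; this is the tangent plane bound
   at the polar angle t0. *)
Lemma polar_tangent al s t0 t :
  0 <= t0 <= t -> 0 < t <= PI / 2 -> 0 < al -> al * cos t = s * sin t ->
  s * cos t0 ^ 2 + al * (t0 + sin t0 * cos t0) <= s + al * t.
Proof.
  intros H0 Ht Hal Hpol. pose proof PI_bounds.
  assert (Hs : 0 < sin t) by (apply sin_gt_0; lra).
  assert (Hm : sin t0 <= sin t) by (apply sin_incr_1; lra).
  assert (H00 : 0 <= sin t0) by (apply sin_ge_0; lra).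
  assert (Hd : sin (t - t0) <= t - t0).
  { destruct (Req_dec t t0) as [-> | ].
    - rewrite Rminus_diag, sin_0. lra.
    - apply Rlt_le, sin_lt_x. lra. }
  (* Multiplied by sin t, with s sin t replaced by al cos t, the claim becomes al times this
     inequality. *)
  assert (Hmain : 0 <= (t - t0) * sin t - sin t0 * sin (t - t0)) by nra.
  rewrite sin_minus in Hmain.
  apply Rmult_le_reg_r with (sin t); [assumption|].
  pose proof (sin2_cos2 t0) as Hsc. unfold Rsqr in Hsc.
  assert (E : s * sin t - s * cos t0 ^ 2 * sin t = al * cos t * sin t0 ^ 2).
  { rewrite Hpol. replace (sin t0 ^ 2) with (1 - cos t0 ^ 2) by nra. ring. }
  assert (0 <= al * ((t - t0) * sin t
     - sin t0 * (sin t * cos t0 - cos t * sin t0))) by (apply Rmult_le_pos; lra).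
  lra.
Qed.

(** The numerical core of [risk_below_curve], with P = PI^2/4, z = t0^2 and w = 1 - sin t0 cos t0 /
    t0. *)
Lemma below_curve_scalar (P z w : R) :
  2.46 <= P <= 2.47 -> 0 <= z <= 2.5 -> 0 <= w < 1 / 2 ->
  2 / 3 * z - 2 / 15 * z ^ 2 <= w ->
  (1 - 2 * w) ^ 2 * (P - 1 + 4 * w) <= P - 1 - z.
Proof.
  intros HP Hz Hw H.
  (* The left side of the last hypothesis increases up to z = 5/2 and is already 8/15 > 1/2 at z =
     1. *)
  assert (Hz1 : z <= 1) by nra.
  (* Expanded, the goal reads z <= 4(P - 2) w + 4(5 - P) w^2 - 16 w^3, and 16 w^3 <= 8 w^2. *)
  assert (H1 : z <= 4 * (P - 2) * w + (4 * (5 - P) - 8) * w ^ 2).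
  { assert (8 / 15 * z <= w) by nra. nra. }
  assert (w ^ 3 <= w ^ 2 / 2) by nra.
  nra.
Qed.

(** The function (P + 1) x^2 - 2 x^3 has derivative 2x (P + 1 - 3x), which is nonnegative on
    [0, 1]. *)
Lemma below_curve_monotone (P u x : R) :
  2.46 <= P -> 0 <= u <= x -> x <= 1 ->
  u ^ 2 * (P - 1 + 2 * (1 - u)) <= x ^ 2 * (P - 1 + 2 * (1 - x)).
Proof.
  intros HP Hu Hx.
  assert (0 <= (x - u) * ((P + 1) * (x + u) - 2 * (x ^ 2 + x * u + u ^ 2))).
  { apply Rmult_le_pos; nra. }
  lra.
Qed.

(** Put P = PI^2/4, c = t0 cot t0, v = sin(2 t0) / (2 t0), and let u be the ratio of s to the height
    2c/PI of the curve above al. The tangent plane bound at t0 and [fixed_curve_ineq] give P risk <=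
    c^2 (P - 1 + (1 - u)(2v - 1 - u)). The last product is positive only for u < 2v - 1, and the
    lower bound on delta s^2 restricts such u through P - 1 - t0^2 <= delta u^2. *)
Lemma risk_below_curve delta al s t0 t :
  delta > PI ^ 2 / 4 - 1 -> 0 < t0 < t -> t <= PI / 2 -> al = 2 * t0 / PI ->
  0 <= s -> al * cos t = s * sin t ->
  1 - 4 / PI ^ 2 - al ^ 2 <= delta * s ^ 2 ->
  risk al s t <= (delta + (PI ^ 2 / 4 - 1)) / 2 * (al * cos t0 / sin t0) ^ 2.
Proof.
  intros Hdelta Ht0 Ht Eal Hs Hpol Hlow. pose proof PI_bounds as HPI.
  set (P := PI ^ 2 / 4) in *. assert (HP : 2.46 <= P <= 2.47) by (unfold P; nra).
  assert (HS : 0 < sin t0) by (apply sin_gt_0; lra).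
  assert (HC : 0 < cos t0) by (apply cos_gt_0; lra).
  assert (Hal : 0 < al) by (rewrite Eal; apply Rdiv_lt_0_compat; lra).
  pose proof (polar_tangent al s t0 t ltac:(lra) ltac:(lra) Hal Hpol) as Htan.
  set (c := t0 * cos t0 / sin t0).
  set (v := sin t0 * cos t0 / t0).
  assert (Hc : 0 < c) by (apply Rdiv_lt_0_compat; [apply Rmult_lt_0_compat; lra | lra]).
  assert (Hc1 : c <= 1).
  { unfold c. apply Rmult_le_reg_r with (sin t0); [lra|].
    replace (t0 * cos t0 / sin t0 * sin t0) with (t0 * cos t0) by (field; lra).
    pose proof (x_cos_le_sin t0 ltac:(lra)). lra. }
  assert (Hv0 : 0 < v) by (apply Rdiv_lt_0_compat; [apply Rmult_lt_0_compat; lra | lra]).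
  assert (Hv1 : v <= 1).
  { unfold v. apply Rmult_le_reg_r with t0; [lra|].
    replace (sin t0 * cos t0 / t0 * t0) with (sin t0 * cos t0) by (field; lra).
    pose proof (sin_lt_x t0 ltac:(lra)). pose proof (COS_bound t0). nra. }
  set (u := PI * s / (2 * c)).
  assert (Es : s = u * (2 / PI * c)) by (unfold u; field; lra).
  assert (Hu : 0 <= u).
  { unfold u. apply Rmult_le_pos; [nra|]. apply Rlt_le, Rinv_0_lt_compat. lra. }
  assert (Hst : 0 < sin t) by (apply sin_gt_0; lra).
  assert (Hu1 : u <= 1).
  { (* i.e. s <= al cot t0, since cot is decreasing *)
    assert (Hsin : 0 <= sin (t - t0)) by (apply sin_ge_0; lra).
    rewrite sin_minus in Hsin.
    apply Rmult_le_reg_r with (2 / PI * c); [apply Rmult_lt_0_compat;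
      [apply Rdiv_lt_0_compat|]; lra|].
    rewrite <- Es. apply Rmult_le_reg_r with (sin t * sin t0); [apply Rmult_lt_0_compat; lra|].
    replace (1 * (2 / PI * c) * (sin t * sin t0)) with (al * (sin t * cos t0))
      by (rewrite Eal; unfold c; field; lra).
    replace (s * (sin t * sin t0)) with (al * (cos t * sin t0)) by (rewrite <- !Rmult_assoc, <- Hpol; ring).
    apply Rmult_le_compat_l; lra. }
  replace (al * cos t0 / sin t0) with (2 / PI * c) by (rewrite Eal; unfold c; field; lra).
  assert (Hrisk : P * risk al s t <= c ^ 2 * (P - 1 + (1 - u) * (2 * v - 1 - u))).
  { pose proof (fixed_curve_ineq t0 ltac:(lra)) as Hcurve. cbv zeta in Hcurve.
    fold c in Hcurve. fold P in Hcurve.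
    apply Rle_trans with
      (P * (al ^ 2 + s ^ 2 + 1) - PI * (s * cos t0 ^ 2 + al * (t0 + sin t0 * cos t0))).
    { replace (P * risk al s t) with (P * (al ^ 2 + s ^ 2 + 1) - PI * (s + al * t))
        by (unfold risk, P; field; lra).
      assert (0 <= PI * (s + al * t - (s * cos t0 ^ 2 + al * (t0 + sin t0 * cos t0))))
        by (apply Rmult_le_pos; lra).
      lra. }
    replace (P * (al ^ 2 + s ^ 2 + 1) - PI * (s * cos t0 ^ 2 + al * (t0 + sin t0 * cos t0)))
      with (P - t0 ^ 2 - 2 * c + c ^ 2 + c ^ 2 * (u ^ 2 - 1) + 2 * c ^ 2 * v * (1 - u)).
    { lra. }
    assert (E1 : c * v = cos t0 ^ 2) by (unfold c, v; field; lra).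
    assert (E2 : t0 * (sin t0 * cos t0) = c - c ^ 2 * v).
    { replace (c ^ 2 * v) with (c * (c * v)) by ring. rewrite E1.
      pose proof (sin2_cos2 t0) as Hsc. unfold Rsqr in Hsc.
      replace (c - c * cos t0 ^ 2) with (c * sin t0 ^ 2) by nra.
      unfold c. field. lra. }
    rewrite <- E1, Es, Eal.
    replace (P * ((2 * t0 / PI) ^ 2 + (u * (2 / PI * c)) ^ 2 + 1)
       - PI * (u * (2 / PI * c) * (c * v) + 2 * t0 / PI * (t0 + sin t0 * cos t0)))
      with (P - t0 ^ 2 + u ^ 2 * c ^ 2 - 2 * u * c ^ 2 * v - 2 * (t0 * (sin t0 * cos t0)))
      by (unfold P; field; lra).
    rewrite E2. ring. }
  assert (Hlow' : P - 1 - t0 ^ 2 <= delta * u ^ 2).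
  { assert (H : P * (1 - 4 / PI ^ 2 - al ^ 2) <= P * (delta * s ^ 2))
      by (apply Rmult_le_compat_l; lra).
    replace (P * (1 - 4 / PI ^ 2 - al ^ 2)) with (P - 1 - t0 ^ 2) in H
      by (rewrite Eal; unfold P; field; lra).
    replace (P * (delta * s ^ 2)) with (delta * u ^ 2 * c ^ 2) in H
      by (rewrite Es; unfold P; field; lra).
    assert (0 <= u ^ 2) by nra. assert (0 <= 1 - c ^ 2) by nra.
    assert (0 <= delta * u ^ 2) by (apply Rmult_le_pos; lra).
    assert (0 <= delta * u ^ 2 * (1 - c ^ 2)) by (apply Rmult_le_pos; assumption).
    lra. }
  assert (Hgap : (1 - u) * (2 * v - 1 - u) <= (delta - (P - 1)) / 2).
  (* For u >= 2v - 1 the product is at most 0. Otherwise the two scalar lemmas give u^2 (P - 1 + 2(1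
     - u)) <= P - 1 - t0^2 <= delta u^2, so 1 - u is at most half of delta - (P - 1), while 2v - 1 -
     u <= 1. *)
  { destruct (Rle_lt_dec (2 * v - 1) u) as [Hle | Hlt].
    - assert (0 <= (1 - u) * (u - (2 * v - 1))) by (apply Rmult_le_pos; lra). lra.
    - pose proof (one_minus_sinc_lower t0 ltac:(lra)) as Hw. fold v in Hw.
      assert (Hz : 0 <= t0 ^ 2 <= 2.5) by (unfold P in *; nra).
      replace (t0 ^ 4) with ((t0 ^ 2) ^ 2) in Hw by ring.
      pose proof (below_curve_scalar P (t0 ^ 2) (1 - v) HP Hz ltac:(lra) Hw) as Hsc.
      replace (1 - 2 * (1 - v)) with (2 * v - 1) in Hsc by ring.
      pose proof (below_curve_monotone P u (2 * v - 1) ltac:(lra) ltac:(lra) ltac:(lra)) as Hmon.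
      replace (2 * (1 - (2 * v - 1))) with (4 * (1 - v)) in Hmon by ring.
      assert (Hpos : 0 < (2 * v - 1) ^ 2 * (P - 1 + 4 * (1 - v))).
      { apply Rmult_lt_0_compat; [apply pow_lt|]; lra. }
      assert (Hu0 : 0 < u ^ 2).
      { assert (0 <= u ^ 2) by nra. destruct (Req_dec (u ^ 2) 0) as [E|]; [|lra].
        rewrite E in Hlow'. lra. }
      assert (P - 1 + 2 * (1 - u) <= delta).
      { apply Rmult_le_reg_l with (u ^ 2); lra. }
      nra. }
  apply Rmult_le_reg_l with P; [lra|].
  replace (P * ((delta + (P - 1)) / 2 * (2 / PI * c) ^ 2))
    with (c ^ 2 * ((delta + (P - 1)) / 2)) by (unfold P; field; lra).
  apply Rle_trans with (1 := Hrisk).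
  apply Rmult_le_compat_l; [nra | lra].
Qed.

(** * Monotonicity of x cot x, the polar angle, and global bounds on the risk *)

(** With d = y - x the claim is d cos y sin x <= x sin d, which follows from sin x <= x, cos y <=
    cos d and d cos d <= sin d. It shows that the curve g decreases. *)
Lemma x_cot_antitone x y :
  0 < x <= y -> y < PI / 2 -> y * cos y / sin y <= x * cos x / sin x.
Proof.
  intros Hx Hy.
  assert (Hsx : 0 < sin x) by (apply sin_gt_0; lra).
  assert (Hsy : 0 < sin y) by (apply sin_gt_0; lra).
  assert (Hcy : 0 < cos y) by (apply cos_gt_0; lra).
  set (d := y - x).
  assert (Hd : d * cos d <= sin d) by (apply x_cos_le_sin; unfold d; lra).
  assert (Hcd : cos y <= cos d) by (apply cos_decr_1; unfold d; lra).
  assert (Hsx' : sin x <= x) by (apply Rlt_le, sin_lt_x; lra).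
  assert (Hkey : d * cos y * sin x <= x * sin d).
  { apply Rle_trans with (d * cos d * x); [|nra].
    apply Rmult_le_compat; [|lra| |lra].
    - apply Rmult_le_pos; unfold d; lra.
    - apply Rmult_le_compat_l; unfold d in *; lra. }
  unfold d in Hkey. rewrite sin_minus in Hkey.
  apply Rmult_le_reg_r with (sin x * sin y); [apply Rmult_lt_0_compat; assumption|].
  replace (y * cos y / sin y * (sin x * sin y)) with (y * cos y * sin x) by (field; lra).
  replace (x * cos x / sin x * (sin x * sin y)) with (x * cos x * sin y) by (field; lra).
  lra.
Qed.

Lemma atan_ratio_polar al s :
  0 < al -> 0 <= s ->
  0 < atan_ratio al s <= PI / 2 /\
  al * cos (atan_ratio al s) = s * sin (atan_ratio al s).
Proof.
  intros Hal Hs. pose proof PI_RGT_0. unfold atan_ratio.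
  destruct (Req_EM_T s 0) as [-> | Hne].
  - destruct (Rlt_dec 0 al) as [_ | H0]; [|lra].
    rewrite cos_PI2, sin_PI2. lra.
  - assert (0 < al / s) by (apply Rdiv_lt_0_compat; lra).
    pose proof (atan_bound (al / s)).
    assert (0 < atan (al / s)) by (rewrite <- atan_0; apply atan_increasing; lra).
    split; [lra|].
    assert (Hc : 0 < cos (atan (al / s))) by (apply cos_gt_0; lra).
    pose proof (tan_atan (al / s)) as Ht. unfold tan in Ht.
    replace (sin (atan (al / s))) with (al / s * cos (atan (al / s)))
      by (rewrite <- Ht at 1; field; lra).
    field. lra.
Qed.

Lemma atan_le_ratio tau al s :
  0 < al -> 0 <= s -> tau * s <= al -> atan tau <= atan_ratio al s.
Proof.
  intros Hal Hs Htau. pose proof (atan_bound tau). unfold atan_ratio.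
  destruct (Req_EM_T s 0) as [-> | Hne].
  - destruct (Rlt_dec 0 al); lra.
  - assert (H1 : tau <= al / s).
    { apply Rmult_le_reg_r with s; [lra|].
      replace (al / s * s) with al by (field; lra). assumption. }
    destruct H1 as [H1 | ->]; [apply Rlt_le, atan_increasing|]; lra.
Qed.

Lemma atan_ratio_opp al s : atan_ratio (- al) s = - atan_ratio al s.
Proof.
  unfold atan_ratio. destruct (Req_EM_T s 0).
  - destruct (Rlt_dec 0 (- al)), (Rlt_dec (- al) 0), (Rlt_dec 0 al), (Rlt_dec al 0); lra.
  - rewrite <- atan_opp. f_equal. field. assumption.
Qed.

(** Squares are completed in al and s. Since 2 t / PI is the next alpha, this is the last clause of
    [reachable] for the image point. *)
Lemma risk_lower al s t :
  1 - 4 / PI ^ 2 - (2 / PI * t) ^ 2 <= risk al s t.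
Proof.
  pose proof PI_RGT_0.
  replace (risk al s t) with
    ((al - 2 / PI * t) ^ 2 + (s - 2 / PI) ^ 2 + (1 - 4 / PI ^ 2 - (2 / PI * t) ^ 2))
    by (unfold risk; field; lra).
  pose proof (pow2_ge_0 (al - 2 / PI * t)). pose proof (pow2_ge_0 (s - 2 / PI)). lra.
Qed.

(** In polar form with radius r, the risk is (r - 1)^2 + (4 r / PI)(PI/2 - (cos t + t sin t)), and
    cos t + t sin t is at most its value PI/2 at t = PI/2. *)
Lemma risk_nonneg al s t :
  0 < t <= PI / 2 -> 0 < al -> al * cos t = s * sin t -> 0 <= risk al s t.
Proof.
  intros Ht Hal Hpol. pose proof PI_bounds.
  assert (Hs : 0 < sin t) by (apply sin_gt_0; lra).
  set (r := al / sin t).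
  assert (Hr : 0 < r) by (apply Rdiv_lt_0_compat; assumption).
  assert (Ea : al = r * sin t) by (unfold r; field; lra).
  assert (Es : s = r * cos t).
  { apply Rmult_eq_reg_r with (sin t); [|lra]. rewrite <- Hpol, Ea. ring. }
  assert (Hm : cos t + t * sin t <= PI / 2).
  { set (x := PI / 2 - t).
    rewrite <- (sin_shift t), <- (cos_shift t). fold x.
    replace t with (PI / 2 - x) by (unfold x; ring).
    assert (0 <= x) by (unfold x; lra).
    assert (Hsx : sin x <= x).
    { destruct (Req_dec x 0) as [-> | ]; [rewrite sin_0; lra|].
      apply Rlt_le, sin_lt_x. lra. }
    pose proof (COS_bound x).
    assert (0 <= (PI / 2 - x) * (1 - cos x)) by (apply Rmult_le_pos; unfold x in *; lra).
    lra. }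
  pose proof (sin2_cos2 t) as Hsc. unfold Rsqr in Hsc.
  replace (risk al s t)
    with ((r - 1) ^ 2 + r ^ 2 * (sin t * sin t + cos t * cos t - 1)
          + 4 / PI * (r * (PI / 2 - (cos t + t * sin t))))
    by (unfold risk; rewrite Ea, Es; field; lra).
  rewrite Hsc.
  assert (0 <= 4 / PI * (r * (PI / 2 - (cos t + t * sin t)))).
  { apply Rmult_le_pos; [apply Rlt_le, Rdiv_lt_0_compat; lra|].
    apply Rmult_le_pos; lra. }
  pose proof (pow2_ge_0 (r - 1)). lra.
Qed.

(** * Contraction of the variance in one step *)

Lemma psi2_risk al v delta :
  0 <= v ->
  psi2 al v delta 0 = risk al (sqrt v) (atan_ratio al (sqrt v)) / delta.
Proof.
  intros Hv. unfold psi2, risk. rewrite pow2_sqrt by assumption.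
  unfold Rdiv. ring.
Qed.

(* The last clause holds for every state that is the image of another one, by [risk_lower]. *)
Definition reachable (delta al v : R) : Prop :=
  0 < al <= 1 /\ 0 <= v /\ 1 - 4 / PI ^ 2 - al ^ 2 <= delta * v.

Lemma step_reachable delta al v :
  0 < delta -> 0 < al -> 0 <= v ->
  reachable delta (psi1 al v) (psi2 al v delta 0).
Proof.
  intros Hd Hal Hv. pose proof PI_RGT_0.
  rewrite psi2_risk by assumption. unfold psi1.
  destruct (atan_ratio_polar al (sqrt v) Hal (sqrt_pos v)) as [Ht Hpol].
  set (t := atan_ratio al (sqrt v)) in *.
  assert (H2 : 0 < 2 / PI) by (apply Rdiv_lt_0_compat; lra).
  repeat split.
  - apply Rmult_lt_0_compat; lra.
  - apply Rle_trans with (2 / PI * (PI / 2)); [apply Rmult_le_compat_l; lra|].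
    apply Req_le. field. lra.
  - apply Rmult_le_pos; [|apply Rlt_le, Rinv_0_lt_compat; lra].
    apply risk_nonneg; assumption.
  - replace (delta * (risk al (sqrt v) t / delta)) with (risk al (sqrt v) t) by (field; lra).
    apply risk_lower.
Qed.

(** The mean of 1 and (PI^2/4 - 1) / delta: above the curve the second number bounds the contraction
    factor, below it half of the gap to 1 is given up. *)
Definition rate (delta : R) : R := (delta + (PI ^ 2 / 4 - 1)) / (2 * delta).

Lemma rate_bounds delta : delta > PI ^ 2 / 4 - 1 -> 0 < rate delta < 1.
Proof.
  intros Hd. pose proof PI_bounds.
  assert (1.46 < PI ^ 2 / 4 - 1) by nra.
  unfold rate. split.
  - apply Rdiv_lt_0_compat; lra.
  - apply Rmult_lt_reg_r with (2 * delta); [lra|].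
    unfold Rdiv. rewrite Rmult_assoc, Rinv_l by lra. lra.
Qed.

(** The cases are next alpha <= alpha (on or above the curve) and next alpha > alpha (below it). The
    second forces al < 1, since the angle is at most PI/2. *)
Lemma step_variance delta al v :
  delta > PI ^ 2 / 4 - 1 -> reachable delta al v ->
  psi2 al v delta 0 <= rate delta * v \/
  (al < 1 /\
   psi2 al v delta 0 <=
     rate delta * (al * cos (PI * al / 2) / sin (PI * al / 2)) ^ 2).
Proof.
  intros Hd [Hal [Hv Hlow]]. pose proof PI_bounds.
  assert (1.46 < PI ^ 2 / 4 - 1) by nra.
  rewrite psi2_risk by assumption.
  destruct (atan_ratio_polar al (sqrt v) ltac:(lra) (sqrt_pos v)) as [Ht Hpol].
  set (t := atan_ratio al (sqrt v)) in *.
  assert (Hdiv : forall x m, x <= (delta + (PI ^ 2 / 4 - 1)) / 2 * m ->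
                             x / delta <= rate delta * m).
  { intros x m Hx. unfold rate. apply Rmult_le_reg_r with delta; [lra|].
    replace (x / delta * delta) with x by (field; lra).
    replace ((delta + (PI ^ 2 / 4 - 1)) / (2 * delta) * m * delta)
      with ((delta + (PI ^ 2 / 4 - 1)) / 2 * m) by (field; lra).
    assumption. }
  destruct (Rle_lt_dec t (PI * al / 2)) as [Hle | Hlt].
  - left. apply Hdiv.
    assert (2 * t / PI <= al).
    { apply Rmult_le_reg_r with PI; [lra|].
      replace (2 * t / PI * PI) with (2 * t) by (field; lra). lra. }
    pose proof (risk_above_curve al (sqrt v) t Ht ltac:(lra) Hpol) as Hr.
    rewrite pow2_sqrt in Hr by assumption.
    assert (0 <= (delta - (PI ^ 2 / 4 - 1)) * v) by (apply Rmult_le_pos; lra).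
    lra.
  - right. split; [nra|]. apply Hdiv.
    apply risk_below_curve with (t := t); try lra.
    + split; [nra | assumption].
    + field. lra.
    + apply sqrt_pos.
    + rewrite pow2_sqrt by assumption. assumption.
Qed.

(** * Boxes and their images *)

(* With a = 2/PI atan tau, the conditions read alpha >= a and sigma <= a cot(PI a / 2). *)
Definition in_box (tau al v : R) : Prop :=
  2 / PI * atan tau <= al /\ tau * sqrt v <= 2 / PI * atan tau.

Lemma atan_pos tau : 0 < tau -> 0 < atan tau < PI / 2.
Proof.
  intros H. pose proof (atan_bound tau).
  assert (0 < atan tau) by (rewrite <- atan_0; apply atan_increasing; lra). lra.
Qed.

(** For alpha: tau sigma <= a <= al with a = 2/PI atan tau. For the variance: both bounds m in
    [step_variance], sigma and g(al), satisfy tau m <= a, the first by the box and the second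
    because g decreases and tau g(a) = a. *)
Lemma box_step delta tau al v :
  delta > PI ^ 2 / 4 - 1 -> 0 < tau -> reachable delta al v -> in_box tau al v ->
  2 / PI * atan tau <= psi1 al v /\
  tau * sqrt (psi2 al v delta 0) <= sqrt (rate delta) * (2 / PI * atan tau).
Proof.
  intros Hd Htau Hre [Hb1 Hb2]. pose proof PI_bounds.
  pose proof (atan_pos tau Htau) as Hat.
  pose proof (rate_bounds delta Hd) as Hq.
  assert (H2 : 0 < 2 / PI) by (apply Rdiv_lt_0_compat; lra).
  pose proof Hre as [Hal [Hv _]].
  split.
  - unfold psi1. apply Rmult_le_compat_l; [lra|].
    apply atan_le_ratio; [lra | apply sqrt_pos | lra].
  - assert (Hm : forall m, 0 <= m -> tau * m <= 2 / PI * atan tau ->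
                 psi2 al v delta 0 <= rate delta * m ^ 2 ->
                 tau * sqrt (psi2 al v delta 0)
                   <= sqrt (rate delta) * (2 / PI * atan tau)).
    { intros m Hm0 Hm1 Hm2.
      apply Rle_trans with (tau * sqrt (rate delta * m ^ 2)).
      { apply Rmult_le_compat_l; [lra|]. apply sqrt_le_1_alt. assumption. }
      rewrite sqrt_mult, sqrt_pow2 by (try apply pow2_ge_0; lra).
      replace (tau * (sqrt (rate delta) * m)) with (sqrt (rate delta) * (tau * m)) by ring.
      apply Rmult_le_compat_l; [apply sqrt_pos | assumption]. }
    destruct (step_variance delta al v Hd Hre) as [H1 | [Hal1 H1]].
    + apply (Hm (sqrt v)); [apply sqrt_pos | assumption |].
      rewrite pow2_sqrt; assumption.
    + set (y := PI * al / 2) in *.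
      assert (Hy : atan tau <= y).
      { unfold y. apply Rmult_le_reg_l with (2 / PI); [lra|].
        replace (2 / PI * (PI * al / 2)) with al by (field; lra). assumption. }
      assert (Hy2 : y < PI / 2) by (unfold y; nra).
      assert (0 < sin y) by (apply sin_gt_0; lra).
      assert (0 < cos y) by (apply cos_gt_0; lra).
      apply (Hm (al * cos y / sin y)); [| | assumption].
      * apply Rlt_le, Rdiv_lt_0_compat; [apply Rmult_lt_0_compat; lra | assumption].
      * pose proof (x_cot_antitone (atan tau) y ltac:(lra) Hy2) as Hcot.
        assert (Hs : 0 < sin (atan tau)) by (apply sin_gt_0; lra).
        assert (Hc : 0 < cos (atan tau)) by (apply cos_gt_0; lra).
        pose proof (tan_atan tau) as Htan. unfold tan in Htan.
        assert (Eal : al = 2 / PI * y) by (unfold y; field; lra).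
        replace (al * cos y / sin y) with (2 / PI * (y * cos y / sin y))
          by (rewrite Eal; field; lra).
        apply Rle_trans with
          (tau * (2 / PI * (atan tau * cos (atan tau) / sin (atan tau)))).
        { apply Rmult_le_compat_l; [lra|]. apply Rmult_le_compat_l; lra. }
        rewrite <- Htan at 1. apply Req_le. field. lra.
Qed.

Lemma exists_box al v :
  0 < al -> 0 <= v -> v < (2 / PI) ^ 2 -> exists tau, 0 < tau /\ in_box tau al v.
Proof.
  intros Hal Hv Hv2. pose proof PI_bounds.
  assert (H2 : 0 < 2 / PI) by (apply Rdiv_lt_0_compat; lra).
  set (s := sqrt v).
  assert (Hs : 0 <= s) by apply sqrt_pos.
  assert (Hs2 : s < 2 / PI).
  { unfold s. rewrite <- (sqrt_pow2 (2 / PI)) by lra. apply sqrt_lt_1_alt. lra. }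
  set (r := PI / 2 * s).
  assert (Hr : 0 <= r < 1).
  { unfold r. split; [apply Rmult_le_pos; lra|].
    apply Rmult_lt_reg_l with (2 / PI); [lra|].
    replace (2 / PI * (PI / 2 * s)) with s by (field; lra). lra. }
  (* The witness is tan x, so a = 2x/PI. The choice gives a <= al, and r <= 1 - x <= cos x, whence r
     tan x <= sin x <= x. *)
  set (x := Rmin al (1 - r)).
  assert (Hx : 0 < x) by (apply Rmin_glb_lt; lra).
  assert (Hxa : x <= al) by apply Rmin_l.
  assert (Hxr : x <= 1 - r) by apply Rmin_r.
  assert (Hsx : 0 < sin x) by (apply sin_gt_0; lra).
  assert (Hsx' : sin x <= x) by (apply Rlt_le, sin_lt_x; lra).
  assert (Hcr : r <= cos x).
  { pose proof (cos_lower_6 x ltac:(lra)) as Hc.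
    assert (0 <= x ^ 4 * (30 - x ^ 2)).
    { apply Rmult_le_pos; [apply pow_le; lra | nra]. }
    nra. }
  assert (Hcx : 0 < cos x) by (apply cos_gt_0; lra).
  exists (tan x). unfold in_box. rewrite atan_tan by lra. fold s.
  split; [unfold tan; apply Rdiv_lt_0_compat; assumption|]. split.
  - assert (2 / PI <= 1).
    { apply Rmult_le_reg_r with PI; [lra|].
      replace (2 / PI * PI) with 2 by (field; lra). lra. }
    nra.
  - replace s with (2 / PI * r) by (unfold r; field; lra).
    unfold tan. apply Rmult_le_reg_r with (cos x); [assumption|].
    replace (sin x / cos x * (2 / PI * r) * cos x) with (2 / PI * (sin x * r))
      by (field; lra).
    rewrite Rmult_assoc. apply Rmult_le_compat_l; [lra|].
    apply Rmult_le_compat; lra.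
Qed.

(** * Orbits with a positive start *)

Lemma SE_nonneg delta al0 v0 n :
  delta > PI ^ 2 / 4 - 1 -> 0 < al0 -> 0 <= v0 ->
  0 < alpha_seq delta 0 al0 v0 n /\ 0 <= sigma2_seq delta 0 al0 v0 n.
Proof.
  intros Hd Ha Hv. pose proof PI_bounds.
  assert (0 < delta) by nra.
  induction n as [|n [IHa IHv]]; [split; assumption|].
  destruct (step_reachable delta _ _ ltac:(assumption) IHa IHv) as [H1 [H2 _]].
  split; [apply H1 | exact H2].
Qed.

Lemma SE_reachable delta al0 v0 n :
  delta > PI ^ 2 / 4 - 1 -> 0 < al0 -> 0 <= v0 ->
  reachable delta (alpha_seq delta 0 al0 v0 (S n)) (sigma2_seq delta 0 al0 v0 (S n)).
Proof.
  intros Hd Ha Hv. pose proof PI_bounds.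
  destruct (SE_nonneg delta al0 v0 n Hd Ha Hv) as [H1 H2].
  apply step_reachable; [nra | exact H1 | exact H2].
Qed.

(** As x cot x <= 1, the curve stays below 2/PI, so each step gives at most q max(sigma^2, B) with B
    = (2/PI)^2. The orbit is thus bounded by q B plus a geometric term, which finally drops below (1
    - q) B. *)
Lemma sigma2_eventually_small delta al0 v0 :
  delta > PI ^ 2 / 4 - 1 -> 0 < al0 -> 0 <= v0 ->
  exists n, sigma2_seq delta 0 al0 v0 (S n) < (2 / PI) ^ 2.
Proof.
  intros Hd Ha Hv. pose proof PI_bounds.
  pose proof (rate_bounds delta Hd) as Hq. set (q := rate delta) in *.
  set (B := (2 / PI) ^ 2).
  assert (H2 : 0 < 2 / PI) by (apply Rdiv_lt_0_compat; lra).
  assert (HB : 0 < B) by (apply pow_lt; assumption).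
  set (v := sigma2_seq delta 0 al0 v0).
  assert (Hv1 : 0 <= v 1%nat) by (apply SE_nonneg; assumption).
  assert (Hind : forall n, v (S n) <= q ^ n * v 1%nat + q * B).
  { induction n as [|n IH]; [simpl; nra|].
    assert (Hqn : 0 <= q ^ S n * v 1%nat)
      by (apply Rmult_le_pos; [apply pow_le; lra | assumption]).
    pose proof (SE_reachable delta al0 v0 n Hd Ha Hv) as Hre.
    change (psi2 (alpha_seq delta 0 al0 v0 (S n)) (v (S n)) delta 0
            <= q ^ S n * v 1%nat + q * B).
    destruct (step_variance delta _ _ Hd Hre) as [H1 | [Hlt H1]]; fold v q in H1.
    - apply Rle_trans with (1 := H1).
      apply Rle_trans with (q * (q ^ n * v 1%nat + q * B)); [apply Rmult_le_compat_l; lra|].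
      assert (q * (q * B) <= 1 * (q * B)) by (apply Rmult_le_compat_r; nra).
      simpl. lra.
    - destruct Hre as [Hal _].
      set (al := alpha_seq delta 0 al0 v0 (S n)) in *.
      set (y := PI * al / 2) in *.
      assert (Hy : 0 < y < PI / 2) by (unfold y; nra).
      assert (Hsy : 0 < sin y) by (apply sin_gt_0; lra).
      assert (Hcy : 0 < cos y) by (apply cos_gt_0; lra).
      assert (Hg : 0 <= al * cos y / sin y <= 2 / PI).
      { split; [apply Rlt_le, Rdiv_lt_0_compat; [apply Rmult_lt_0_compat|]; lra|].
        pose proof (x_cos_le_sin y ltac:(lra)) as Hxc.
        apply Rmult_le_reg_r with (sin y); [assumption|].
        assert (Eal : al = 2 / PI * y) by (unfold y; field; lra).
        replace (al * cos y / sin y * sin y) with (2 / PI * (y * cos y))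
          by (rewrite Eal; field; lra).
        apply Rmult_le_compat_l; lra. }
      assert (Hg2 : (al * cos y / sin y) ^ 2 <= B) by (apply pow_incr; assumption).
      apply Rle_trans with (1 := H1).
      assert (q * (al * cos y / sin y) ^ 2 <= q * B) by (apply Rmult_le_compat_l; lra).
      lra. }
  (* Adding 1 keeps the denominator positive when the variance at time 1 is 0. *)
  destruct (pow_lt_1_zero q ltac:(rewrite Rabs_pos_eq; lra)
              ((1 - q) * B / (v 1%nat + 1))) as [N HN].
  { apply Rdiv_lt_0_compat; [apply Rmult_lt_0_compat|]; lra. }
  exists N. fold v. specialize (HN N (le_n N)). specialize (Hind N).
  assert (HqN : 0 <= q ^ N) by (apply pow_le; lra).
  rewrite Rabs_pos_eq in HN by assumption.
  assert (q ^ N * (v 1%nat + 1) < (1 - q) * B).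
  { apply Rmult_lt_reg_r with (/ (v 1%nat + 1)); [apply Rinv_0_lt_compat; lra|].
    rewrite Rmult_assoc, Rinv_r by lra. unfold Rdiv in HN. lra. }
  lra.
Qed.

(** Times are written [S n] because [reachable] is available from time 1 on. *)
Definition eventually_in_box (delta al0 v0 tau : R) : Prop :=
  exists T, forall n, (T <= n)%nat ->
    in_box tau (alpha_seq delta 0 al0 v0 (S n)) (sigma2_seq delta 0 al0 v0 (S n)).

Lemma eventually_in_some_box delta al0 v0 :
  delta > PI ^ 2 / 4 - 1 -> 0 < al0 -> 0 <= v0 ->
  exists tau, 0 < tau /\ eventually_in_box delta al0 v0 tau.
Proof.
  intros Hd Ha Hv. pose proof PI_bounds.
  destruct (sigma2_eventually_small delta al0 v0 Hd Ha Hv) as [T HT].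
  destruct (SE_nonneg delta al0 v0 (S T) Hd Ha Hv) as [Ha1 Hv1].
  destruct (exists_box _ _ Ha1 Hv1 HT) as [tau [Htau Hbox]].
  exists tau. split; [assumption|]. exists T. intros n Hn.
  induction Hn as [|n Hn IH]; [assumption|].
  pose proof (SE_reachable delta al0 v0 n Hd Ha Hv) as Hre.
  destruct (box_step delta tau _ _ Hd Htau Hre IH) as [H1 H2].
  split; [exact H1|]. apply Rle_trans with (1 := H2).
  pose proof (rate_bounds delta Hd) as Hq. pose proof (atan_pos tau Htau).
  assert (sqrt (rate delta) <= 1) by (rewrite <- sqrt_1; apply sqrt_le_1_alt; lra).
  assert (0 < 2 / PI * atan tau)
    by (apply Rmult_lt_0_compat; [apply Rdiv_lt_0_compat|]; lra).
  nra.
Qed.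

(** One step shrinks sigma by the factor p = sqrt(rate) relative to the box. The next step turns
    this into a larger angle, at least atan(tau / p), while sigma again satisfies the shrunken
    bound. *)
Lemma eventually_in_next_box delta al0 v0 tau :
  delta > PI ^ 2 / 4 - 1 -> 0 < al0 -> 0 <= v0 -> 0 < tau ->
  eventually_in_box delta al0 v0 tau ->
  eventually_in_box delta al0 v0 (tau / sqrt (rate delta)).
Proof.
  intros Hd Ha Hv Htau [T HT]. pose proof PI_bounds.
  pose proof (rate_bounds delta Hd) as Hq.
  set (p := sqrt (rate delta)).
  assert (Hp : 0 < p) by (apply sqrt_lt_R0; lra).
  assert (Hp1 : p <= 1) by (unfold p; rewrite <- sqrt_1; apply sqrt_le_1_alt; lra).
  assert (H2 : 0 < 2 / PI) by (apply Rdiv_lt_0_compat; lra).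
  assert (Hdiv : forall x A, tau * x <= p * A -> tau / p * x <= A).
  { intros x A Hx. apply Rmult_le_reg_l with p; [assumption|].
    replace (p * (tau / p * x)) with (tau * x) by (field; lra). assumption. }
  exists (S (S T)). intros [|[|n]] Hn; [lia | lia |].
  pose proof (box_step delta tau _ _ Hd Htau (SE_reachable delta al0 v0 n Hd Ha Hv)
                (HT n ltac:(lia))) as [B1 B2].
  pose proof (box_step delta tau _ _ Hd Htau (SE_reachable delta al0 v0 (S n) Hd Ha Hv)
                (HT (S n) ltac:(lia))) as [_ C2].
  fold p in B2, C2. apply Hdiv in B2. apply Hdiv in C2.
  change (psi2 (alpha_seq delta 0 al0 v0 (S n)) (sigma2_seq delta 0 al0 v0 (S n)) delta 0)
    with (sigma2_seq delta 0 al0 v0 (S (S n))) in B2.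
  change (psi1 (alpha_seq delta 0 al0 v0 (S n)) (sigma2_seq delta 0 al0 v0 (S n)))
    with (alpha_seq delta 0 al0 v0 (S (S n))) in B1.
  assert (Hmono : atan tau <= atan (tau / p)).
  { assert (tau <= tau / p).
    { apply Rmult_le_reg_r with p; [assumption|].
      replace (tau / p * p) with tau by (field; lra). nra. }
    destruct (Req_dec tau (tau / p)) as [<- | ]; [lra|].
    apply Rlt_le, atan_increasing. lra. }
  pose proof (SE_nonneg delta al0 v0 (S (S n)) Hd Ha Hv) as [Hpos _].
  split.
  - change (2 / PI * atan (tau / p) <=
      psi1 (alpha_seq delta 0 al0 v0 (S (S n))) (sigma2_seq delta 0 al0 v0 (S (S n)))).
    unfold psi1. apply Rmult_le_compat_l; [lra|].
    apply atan_le_ratio; [assumption | apply sqrt_pos | lra].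
  - apply Rle_trans with (1 := C2). apply Rmult_le_compat_l; lra.
Qed.

Lemma eventually_in_large_box delta al0 v0 K :
  delta > PI ^ 2 / 4 - 1 -> 0 < al0 -> 0 <= v0 -> 0 < K ->
  exists tau, K <= tau /\ eventually_in_box delta al0 v0 tau.
Proof.
  intros Hd Ha Hv HK.
  pose proof (rate_bounds delta Hd) as Hq.
  destruct (eventually_in_some_box delta al0 v0 Hd Ha Hv) as [tau0 [Htau0 Hbox0]].
  set (p := sqrt (rate delta)).
  assert (Hp : 0 < p) by (apply sqrt_lt_R0; lra).
  assert (Hp1 : p < 1) by (unfold p; rewrite <- sqrt_1; apply sqrt_lt_1_alt; lra).
  assert (Hall : forall k, eventually_in_box delta al0 v0 (tau0 / p ^ k)).
  { induction k as [|k IH].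
    - simpl. unfold Rdiv. rewrite Rinv_1, Rmult_1_r. assumption.
    - assert (Hpk : 0 < p ^ k) by (apply pow_lt; assumption).
      replace (tau0 / p ^ S k) with (tau0 / p ^ k / p) by (simpl; field; lra).
      apply eventually_in_next_box; try assumption.
      apply Rdiv_lt_0_compat; assumption. }
  destruct (pow_lt_1_zero p ltac:(rewrite Rabs_pos_eq; lra) (tau0 / K)) as [k Hk].
  { apply Rdiv_lt_0_compat; assumption. }
  specialize (Hk k (le_n k)).
  assert (Hpk : 0 < p ^ k) by (apply pow_lt; assumption).
  rewrite Rabs_pos_eq in Hk by lra.
  exists (tau0 / p ^ k). split; [|apply Hall].
  apply Rmult_le_reg_r with (p ^ k / K); [apply Rdiv_lt_0_compat; assumption|].
  replace (K * (p ^ k / K)) with (p ^ k) by (field; lra).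
  replace (tau0 / p ^ k * (p ^ k / K)) with (tau0 / K) by (field; lra).
  lra.
Qed.

(** Here PI/2 - atan tau = atan(1 / tau) <= 1 / tau, and 2/PI <= 1. *)
Lemma one_minus_atan_le tau : 0 < tau -> 1 - 2 / PI * atan tau <= / tau.
Proof.
  intros Htau. pose proof PI_bounds.
  pose proof (atan_inv tau Htau) as Hinv.
  pose proof (atan_pos tau Htau) as Hat.
  assert (Hi : 0 < / tau) by (apply Rinv_0_lt_compat; assumption).
  set (x := PI / 2 - atan tau) in *.
  assert (Hx : x <= / tau).
  { pose proof (x_cos_le_sin x ltac:(unfold x; lra)) as Hxc.
    assert (Hc : 0 < cos x) by (apply cos_gt_0; unfold x; lra).
    pose proof (tan_atan (/ tau)) as Ht. rewrite Hinv in Ht. unfold tan in Ht.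
    rewrite <- Ht. apply Rmult_le_reg_r with (cos x); [assumption|].
    replace (sin x / cos x * cos x) with (sin x) by (field; lra). assumption. }
  replace (1 - 2 / PI * atan tau) with (2 / PI * x) by (unfold x; field; lra).
  assert (2 / PI <= 1).
  { apply Rmult_le_reg_r with PI; [lra|].
    replace (2 / PI * PI) with 2 by (field; lra). lra. }
  assert (0 <= x) by (unfold x; lra).
  nra.
Qed.

Lemma SE_converges_pos delta al0 v0 :
  delta > PI ^ 2 / 4 - 1 -> 0 < al0 -> 0 <= v0 ->
  Un_cv (alpha_seq delta 0 al0 v0) 1 /\ Un_cv (sigma2_seq delta 0 al0 v0) 0.
Proof.
  intros Hd Ha Hv.
  assert (Hmain : forall eps, eps > 0 -> exists N, forall n, (n >= N)%nat ->
    Rabs (alpha_seq delta 0 al0 v0 n - 1) < eps /\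
    Rabs (sigma2_seq delta 0 al0 v0 n - 0) < eps).
  { intros eps Heps.
    assert (Hie : 0 < / eps) by (apply Rinv_0_lt_compat; assumption).
    (* From tau >= 1 + 1/eps come 1/tau < eps and 1/tau <= 1; the latter turns sigma <= 1/tau into
       sigma^2 <= 1/tau. *)
    destruct (eventually_in_large_box delta al0 v0 (1 + / eps) Hd Ha Hv ltac:(lra))
      as [tau [Htau [T HT]]].
    exists (S T). intros [|n] Hn; [lia|].
    destruct (HT n ltac:(lia)) as [B1 B2].
    destruct (SE_reachable delta al0 v0 n Hd Ha Hv) as [[Hal0 Hal1] [Hv0 _]].
    set (al := alpha_seq delta 0 al0 v0 (S n)) in *.
    set (v := sigma2_seq delta 0 al0 v0 (S n)) in *.
    pose proof (one_minus_atan_le tau ltac:(lra)) as Hat.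
    assert (Hsmall : / tau < eps).
    { rewrite <- (Rinv_inv eps). apply Rinv_0_lt_contravar; lra. }
    assert (Hone : / tau <= 1).
    { rewrite <- Rinv_1. apply Rinv_le_contravar; lra. }
    assert (Hs : sqrt v <= / tau).
    { apply Rmult_le_reg_l with tau; [lra|]. rewrite Rinv_r by lra. lra. }
    pose proof (sqrt_pos v) as Hs0.
    assert (Hv1 : v <= / tau) by (rewrite <- (pow2_sqrt v) by assumption; nra).
    split; apply Rabs_def1; lra. }
  split; intros eps Heps; destruct (Hmain eps Heps) as [N HN];
    exists N; intros n Hn; apply HN; assumption.
Qed.

(** * Sign symmetry and conclusion *)

(** [psi1] is odd and [psi2] even in alpha, which reduces a negative start to a positive one. *)
Lemma SE_opp delta sw2 al0 v0 n :
  alpha_seq delta sw2 (- al0) v0 n = - alpha_seq delta sw2 al0 v0 n /\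
  sigma2_seq delta sw2 (- al0) v0 n = sigma2_seq delta sw2 al0 v0 n.
Proof.
  unfold alpha_seq, sigma2_seq.
  induction n as [|n [IHa IHv]]; [split; reflexivity|].
  simpl. rewrite IHa, IHv. unfold psi1, psi2. rewrite atan_ratio_opp.
  split; [ring|]. f_equal. f_equal. unfold Rdiv. ring.
Qed.

Theorem mainTheorem4 (delta alpha0 s20 : R) :
  delta > PI ^ 2 / 4 - 1 ->
  alpha0 <> 0 ->
  0 <= s20 ->
  Un_cv (fun t => Rabs (alpha_seq delta 0 alpha0 s20 t)) 1 /\
  Un_cv (fun t => sigma2_seq delta 0 alpha0 s20 t) 0.
Proof.
  intros Hd Ha Hs.
  assert (Hpos : 0 < Rabs alpha0) by (apply Rabs_pos_lt; assumption).
  destruct (SE_converges_pos delta (Rabs alpha0) s20 Hd Hpos Hs) as [Ca Cs].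
  assert (Heq : forall t,
    Rabs (alpha_seq delta 0 alpha0 s20 t) = alpha_seq delta 0 (Rabs alpha0) s20 t /\
    sigma2_seq delta 0 alpha0 s20 t = sigma2_seq delta 0 (Rabs alpha0) s20 t).
  { intros t.
    destruct (SE_nonneg delta (Rabs alpha0) s20 t Hd Hpos Hs) as [Hp _].
    destruct (Rle_lt_dec 0 alpha0) as [Hge | Hneg].
    - rewrite (Rabs_pos_eq alpha0) in * by assumption.
      split; [|reflexivity]. apply Rabs_pos_eq. lra.
    - rewrite (Rabs_left alpha0) in * by assumption.
      destruct (SE_opp delta 0 alpha0 s20 t) as [E1 E2].
      rewrite E1, E2 in *. split; [|reflexivity].
      apply Rabs_left. lra. }
  split; intros eps Heps.
  - destruct (Ca eps Heps) as [N HN]. exists N. intros n Hn.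
    rewrite (proj1 (Heq n)). apply HN, Hn.
  - destruct (Cs eps Heps) as [N HN]. exists N. intros n Hn.
    rewrite (proj2 (Heq n)). apply HN, Hn.
Qed.
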